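(* Let $n=3$, let the privacy function be the squared Euclidean distance (SED), and assume (without loss of generality) that $m_1\geqslant m_2\geqslant m_3$. Then one of the following two cases holds: - ($j=1$) $w_2\leqslant d_2\,\overline{m}_2$ and $m_1>m_3$; or - ($j=2$) $w_2>d_2\,\overline{m}_2$. For the corresponding index $j$, and for any $\mu$ with $0\leqslant\mu\leqslant\mu_j$, the optimal disclosure strategy is $$\delta_i^*=\begin{cases}\dfrac{v_{i,2j}}{(j+1)\,d_i}\,\mu, & i\neq 2j,\\[1ex] 0,& i=2j,\end{cases}\qquad i=1,2,3,$$ and the corresponding minimum SED yields the privacy-money function $$\mathcal{R}_{\mathrm{SED}}(\mu)=\frac{\mu^2}{(j+1)\,\sigma^2_{m_{2j}}}.$$
   Context: Let $n=3$, let $p=(p_1,p_2,p_3)$ and $q=(q_1,q_2,q_3)$ be probability distributions with all entries positive and $q_i\neq p_i$ for all $i$; put $d_i=q_i-p_i$. Let $w_i>0$ for $i=1,2,3$ and $\mu_{\max}=w_1+w_2+w_3$. For $\delta=(\delta_1,\delta_2,\delta_3)$ let $t_i=(1-\delta_i)p_i+\delta_iq_i$. For $\mu\in[0,\mu_{\max}]$, $$\mathcal{R}_{\mathrm{SED}}(\mu)=\min_\delta\sum_i(t_i-p_i)^2\quad\text{subject to}\quad\sum_iw_i\delta_i=\mu,\ \ \sum_it_i=1,\ \ 0\leqslant\delta_i\leqslant1,$$ where $\sum_i(t_i-p_i)^2=\sum_i d_i^2\delta_i^2$ and $\sum_i t_i=1$ is equivalent to $\sum_i d_i\delta_i=0$.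 The optimal disclosure strategy $\delta^*$ is the minimizer. Let $m_i=w_i/d_i$. For an index $l$, let $\overline{m}_l$ and $\sigma^2_{m_l}$ be the arithmetic mean and the variance (mean of squared deviations from the mean) of all the slopes $m_1,m_2,m_3$ except the $l$-th one; if $l\notin\{1,2,3\}$ (e.g. $l=4$), the mean and variance are computed from all three slopes. Let $$v_{i,l}=\frac{m_i-\overline{m}_l}{\sigma^2_{m_l}},$$ and for $j=1,2$ define the money thresholds $$\mu_j=\min_{i\neq 2j}\frac{(j+1)\,d_i\,\sigma^2_{m_{2j}}}{m_i-\overline{m}_{2j}},$$ the minimum being over $i\in\{1,2,3\}$ with $i\neq 2j$ (so over $i\in\{1,3\}$ when $j=1$ and over $i\in\{1,2,3\}$ when $j=2$). *)

(* Defs.v *)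
From HB Require Import structures.
From mathcomp Require Import all_boot all_order all_algebra.
From mathcomp Require Import boolp classical_sets reals.
Set Implicit Arguments.
Unset Strict Implicit.
Unset Printing Implicit Defensive.
Import Order.TTheory GRing.Theory Num.Theory.
Local Open Scope classical_set_scope.
Local Open Scope ring_scope.

(* The indices 1, 2, 3 of the mathematical text are
   the elements of 'I_3 of value 0, 1, 2: the element i carries the number
   i.+1.  A parameter [l : nat] below is such a 1-based number, and is allowed
   to lie outside {1, 2, 3}. *)
Definition idx1 : 'I_3 := @Ordinal 3 0 isT.
Definition idx2 : 'I_3 := @Ordinal 3 1 isT.
Definition idx3 : 'I_3 := @Ordinal 3 2 isT.

Section PrivacyMoney.
Variables (R : realType) (p q w : 'I_3 -> R).

Definition disclosed (delta : 'I_3 -> R) (i : 'I_3) : R :=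
  (1 - delta i) * p i + delta i * q i.

Definition SED (delta : 'I_3 -> R) : R :=
  \sum_i (disclosed delta i - p i) ^+ 2.

Definition feasible (mu : R) (delta : 'I_3 -> R) : Prop :=
  [/\ \sum_i w i * delta i = mu,
      \sum_i disclosed delta i = 1
    & forall i, 0 <= delta i <= 1].

Definition optimal (mu : R) (delta : 'I_3 -> R) : Prop :=
  feasible mu delta /\
  forall delta', feasible mu delta' -> SED delta <= SED delta'.

(* The minimum is expressed as an infimum; see [R_SED_optimal]. *)
Definition R_SED (mu : R) : R := inf [set SED delta | delta in feasible mu].

Lemma R_SED_optimal mu delta : optimal mu delta -> R_SED mu = SED delta.
Proof.
move=> [fd mind]; apply/eqP; rewrite eq_le; apply/andP; split.
  apply: ge_inf; last by exists delta.
  by exists (SED delta) => _ [e fe <-]; exact: mind.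
apply: lb_le_inf; first by exists (SED delta), delta.
by move=> _ [e fe <-]; exact: mind.
Qed.

Definition diff (i : 'I_3) : R := q i - p i.

Definition slope (i : 'I_3) : R := w i / diff i.

Definition others (l : nat) : pred 'I_3 := [pred i : 'I_3 | i.+1 != l].

Definition slope_mean (l : nat) : R :=
  (\sum_(i | others l i) slope i) / #|others l|%:R.

Definition slope_var (l : nat) : R :=
  (\sum_(i | others l i) (slope i - slope_mean l) ^+ 2) / #|others l|%:R.

Definition v (i : 'I_3) (l : nat) : R :=
  (slope i - slope_mean l) / slope_var l.

Definition threshold_ratio (j : nat) (i : 'I_3) : R :=
  j.+1%:R * diff i * slope_var (2 * j) / (slope i - slope_mean (2 * j)).

(* [R] has no top element to start the iterated minimum from; the index 1 is
   used instead, as it is odd and so always belongs to the range i <> 2j. *)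
Definition money_threshold (j : nat) : R :=
  \big[Num.min/threshold_ratio j idx1]_(i | others (2 * j) i)
    threshold_ratio j i.

Definition case_holds (j : nat) : Prop :=
  match j with
  | 1 => w idx2 <= diff idx2 * slope_mean 2 /\ slope idx3 < slope idx1
  | 2 => diff idx2 * slope_mean 2 < w idx2
  | _ => False
  end.

End PrivacyMoney.

(* Main.v *)
(** In the variables [x i = diff i * delta i] the cost is the squared norm of
    [x], and the equality constraints say that [x] has sum 0 and inner product
    [mu] with the slopes.  Dropping the box constraints and keeping only a
    support [others l], the minimizer is the multiple of the centered slopes
    [slope i - slope_mean l] with the right inner product.  It stays a
    minimizer among all feasible points as soon as the dropped indices satisfy
    the first-order condition [w i <= diff i * slope_mean l], and it meets the
    box constraints as long as [mu] is below the thresholds, provided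
    [diff i] and [slope i - slope_mean l] have the same sign on the support. *)

Require Import Defs.
From HB Require Import structures.
From mathcomp Require Import all_boot all_order all_algebra.
From mathcomp Require Import boolp classical_sets reals.
From mathcomp Require Import ring lra.
Set Implicit Arguments.
Unset Strict Implicit.
Unset Printing Implicit Defensive.
Import Order.TTheory GRing.Theory Num.Theory.
Local Open Scope ring_scope.

Section Disclosure.
Variables (R : realType) (p q w : 'I_3 -> R).
Local Notation d := (diff p q).
Local Notation m := (slope p q w).
Local Notation mean := (slope_mean p q w).
Local Notation var := (slope_var p q w).

Lemma SED_diff delta : SED p q delta = \sum_i (d i * delta i) ^+ 2.
Proof. by apply: eq_bigr => i _; rewrite /disclosed /diff; ring. Qed.

Lemma sum_disclosed delta : \sum_i p i = 1 ->
  \sum_i disclosed p q delta i = 1 + \sum_i d i * delta i.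
Proof.
move=> <-; rewrite -big_split /=.
by apply: eq_bigr => i _; rewrite /disclosed /diff; ring.
Qed.

Lemma feasible_sums mu delta : \sum_i p i = 1 ->
  feasible p q w mu delta <->
  [/\ \sum_i w i * delta i = mu, \sum_i d i * delta i = 0
    & forall i, 0 <= delta i <= 1].
Proof.
by move=> p1; split=> -[wd dd bd]; split=> //; move: dd;
  rewrite sum_disclosed // => /eqP dd; apply/eqP; lra.
Qed.

Lemma sum_diff : \sum_i p i = 1 -> \sum_i q i = 1 -> \sum_i d i = 0.
Proof. by move=> p1 q1; rewrite sumrB p1 q1 subrr. Qed.

Lemma sum_slope_centered l : (0 < #|others l|)%N ->
  \sum_(i | others l i) (m i - mean l) = 0.
Proof.
move=> n0; rewrite sumrB sumr_const /slope_mean.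
rewrite -[_ *+ _]mulr_natr divfK ?subrr //.
by rewrite pnatr_eq0 -lt0n.
Qed.

Lemma sum_slope_centered_sqr l : (0 < #|others l|)%N ->
  \sum_(i | others l i) (m i - mean l) ^+ 2 = #|others l|%:R * var l.
Proof.
by move=> n0; rewrite /slope_var mulrC divfK // pnatr_eq0 -lt0n.
Qed.

(** As [d i * delta i] sums to zero, subtracting [mean l] from every slope leaves the inner product
    with the slopes unchanged. The correction comes from the dropped indices; its coefficients are
    the slacks in the first-order condition. *)
Lemma sum_slope_centered_diff l delta : (forall i, d i != 0) ->
  \sum_i d i * delta i = 0 ->
  \sum_(i | others l i) (m i - mean l) * (d i * delta i) =
  \sum_i w i * delta i
  + \sum_(i | ~~ others l i) (d i * mean l - w i) * delta i.
Proof.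
move=> d0 dd.
have E i : (m i - mean l) * (d i * delta i) =
    w i * delta i - mean l * (d i * delta i).
  by rewrite /slope; field; exact: d0.
have -> : \sum_i w i * delta i = \sum_i (m i - mean l) * (d i * delta i).
  by rewrite (eq_bigr _ (fun i _ => E i)) sumrB -mulr_sumr dd mulr0 subr0.
rewrite [X in _ = X + _](bigID (others l)) /= -addrA -big_split /=.
by rewrite [X in _ + X]big1 ?addr0 // => i _; rewrite E; ring.
Qed.

Definition proportional_disclosure l (mu : R) i : R :=
  if others l i then v p q w i l / (#|others l|%:R * d i) * mu else 0.

(** One bound gives both optimality and uniqueness: the excess cost of a feasible point over the
    candidate is at least their squared distance in the variables [d i * delta i]. *)
Lemma optimal_proportional_disclosure l (mu : R) :
  \sum_i p i = 1 -> (forall i, d i != 0) -> (0 < #|others l|)%N ->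
  (forall i, others l i -> 0 < d i * (m i - mean l)) ->
  (forall i, ~~ others l i -> w i <= d i * mean l) ->
  0 <= mu ->
  (forall i, others l i ->
     mu <= #|others l|%:R * d i * var l / (m i - mean l)) ->
  (forall delta, optimal p q w mu delta <->
     forall i, delta i = proportional_disclosure l mu i) /\
  R_SED p q w mu = mu ^+ 2 / (#|others l|%:R * var l).
Proof.
move=> p1 d0 n0 same kkt mu0 mule.
set b := proportional_disclosure l mu.
set N := #|others l|%:R * var l.
have n_gt0 : 0 < #|others l|%:R :> R by rewrite ltr0n.
(* [N] is the squared norm of the centered slopes on the support, and [same] makes each of them
   nonzero. *)
have N_gt0 : 0 < N.
  have /card_gt0P[i li] := n0.
  rewrite /N -sum_slope_centered_sqr // (bigD1 i) //=.
  apply: ltr_pwDl; last by apply: sumr_ge0 => k _; exact: sqr_ge0.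
  rewrite exprn_even_gt0 //=; apply: contraTneq (same i li) => ->.
  by rewrite mulr0 ltxx.
have var_neq0 : var l != 0 by move: N_gt0; rewrite pmulr_rgt0 // => /lt0r_neq0.
have n_neq0 := lt0r_neq0 n_gt0.
(* The factor that gives [c] times the centered slopes the inner product [mu] with them. *)
pose c := mu / N.
have c_ge0 : 0 <= c by rewrite divr_ge0 // ltW.
have cN : c * N = mu by rewrite divfK // lt0r_neq0.
have bE i : others l i -> d i * b i = c * (m i - mean l).
  move=> li; rewrite /b /proportional_disclosure li /c /N /v.
  by field; rewrite var_neq0 n_neq0 d0.
have b0 i : ~~ others l i -> b i = 0.
  by rewrite /b /proportional_disclosure => /negbTE ->.
have sum_db f : \sum_i d i * b i * f i =
    c * \sum_(i | others l i) (m i - mean l) * f i.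
  rewrite (bigID (others l)) /= [X in _ + X]big1 ?addr0; last first.
    by move=> i /b0 ->; rewrite mulr0 mul0r.
  by rewrite mulr_sumr; apply: eq_bigr => i li; rewrite bE // mulrA.
have db0 : \sum_i d i * b i = 0.
  transitivity (\sum_i d i * b i * 1); first by apply: eq_bigr => i; rewrite mulr1.
  rewrite (sum_db (fun=> 1)) -mulr_suml sum_slope_centered //.
  by rewrite mul0r mulr0.
have centered_b :
    \sum_(i | others l i) (m i - mean l) * (d i * b i) = mu.
  rewrite -cN /N -sum_slope_centered_sqr // mulr_sumr.
  by apply: eq_bigr => i li; rewrite bE //; ring.
have wb : \sum_i w i * b i = mu.
  rewrite -centered_b sum_slope_centered_diff // [X in _ + X]big1 ?addr0 //.
  by move=> i /b0 ->; rewrite mulr0.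
have SEDb : SED p q b = mu ^+ 2 / N.
  rewrite SED_diff; under eq_bigr do rewrite expr2.
  by rewrite (sum_db (fun i => d i * b i)) centered_b /c; ring.
have box i : 0 <= b i <= 1.
  have [li|/b0 ->] := boolP (others l i); last by rewrite lexx ler01.
  have s_neq0 : m i - mean l != 0.
    by apply: contraTneq (same i li) => ->; rewrite mulr0 ltxx.
  (* This quotient is the bound on [mu] in [mule], rearranged: the value of [mu] at which [b i]
     reaches 1. *)
  have r_gt0 : 0 < d i * N / (m i - mean l).
    have -> : d i * N / (m i - mean l) =
        d i * (m i - mean l) * (N / (m i - mean l) ^+ 2) by field.
    by rewrite mulr_gt0 ?same // divr_gt0 // exprn_even_gt0.
  have -> : b i = mu / (d i * N / (m i - mean l)).
    apply: (mulfI (d0 i)); rewrite bE // /c.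
    by field; rewrite s_neq0 lt0r_neq0 // d0.
  rewrite divr_ge0 ?(ltW r_gt0) //= ler_pdivrMr // mul1r.
  by rewrite /N mulrCA mulrA; exact: mule.
have fb : feasible p q w mu b by apply/feasible_sums.
have gap f : feasible p q w mu f ->
    \sum_i (d i * f i - d i * b i) ^+ 2 <= SED p q f - SED p q b.
  move=> /feasible_sums-/(_ p1)[wf df bf].
  have -> : \sum_i (d i * f i - d i * b i) ^+ 2 =
      SED p q f + SED p q b - 2 * \sum_i d i * b i * (d i * f i).
    rewrite !SED_diff mulr_sumr -big_split -sumrB.
    by apply: eq_bigr => i _ /=; ring.
  (* After expanding the square, it remains to see that the inner product of [b] with [f] is at
     least that of [b] with itself; by [kkt] the dropped indices can only increase it. *)
  suff : SED p q b <= \sum_i d i * b i * (d i * f i) by lra.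
  have -> : SED p q b = c * mu by rewrite SEDb /c; ring.
  rewrite sum_db ler_wpM2l // sum_slope_centered_diff // wf lerDl.
  apply: sumr_ge0 => i /kkt kkti; rewrite mulr_ge0 ?subr_ge0 //.
  by have /andP[] := bf i.
have optb : optimal p q w mu b.
  split=> // f /gap; rewrite -(subr_ge0 (SED p q b)); apply: le_trans.
  by apply: sumr_ge0 => i _; exact: sqr_ge0.
split; last by rewrite (R_SED_optimal optb).
move=> delta; split; last by move=> /funext ->.
(* An optimal [delta] costs no more than [b], so [gap] forces their squared distance to vanish. *)
case=> /gap gapd /(_ _ fb); rewrite -subr_le0 => /(le_trans gapd) le0 i.
have : \sum_i (d i * delta i - d i * b i) ^+ 2 == 0.
  by rewrite eq_le le0 sumr_ge0 // => k _; exact: sqr_ge0.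
rewrite psumr_eq0 => [/allP/(_ i (mem_index_enum i))/=|k _]; last exact: sqr_ge0.
by rewrite sqrf_eq0 subr_eq0 => /eqP/(mulfI (d0 i)).
Qed.

Lemma money_threshold_le j i : others (2 * j) i ->
  money_threshold p q w j <= threshold_ratio p q w j i.
Proof. by move=> li; exact: bigmin_le_cond. Qed.

End Disclosure.

Lemma ord3_ind (P : 'I_3 -> Prop) :
  P idx1 -> P idx2 -> P idx3 -> forall i, P i.
Proof.
move=> P1 P2 P3 [[|[|[|//]]] i3].
- by rewrite (_ : Ordinal _ = idx1) //; exact: val_inj.
- by rewrite (_ : Ordinal _ = idx2) //; exact: val_inj.
- by rewrite (_ : Ordinal _ = idx3) //; exact: val_inj.
Qed.

Lemma sum_ord3 (V : nmodType) (P : pred 'I_3) (F : 'I_3 -> V) :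
  \sum_(i | P i) F i = (if P idx1 then F idx1 else 0)
    + (if P idx2 then F idx2 else 0) + (if P idx3 then F idx3 else 0).
Proof.
rewrite big_mkcond !big_ord_recl big_ord0 /= addr0 addrA.
by congr (_ + _ + _); congr (if P _ then F _ else 0); exact: val_inj.
Qed.

(** For [l = 2 * j] with [j] equal to 1 or 2, the size of the support is [j.+1]. *)
Lemma card_others2 : #|others 2| = 2.
Proof. by rewrite -sum1_card big_mkcond !big_ord_recl big_ord0. Qed.

Lemma card_others4 : #|others 4| = 3.
Proof. by rewrite -sum1_card big_mkcond !big_ord_recl big_ord0. Qed.

Theorem theorem8 (R : realType) (p q w : 'I_3 -> R)
    (p_gt0 : forall i, 0 < p i) (p_sum1 : \sum_i p i = 1)
    (q_gt0 : forall i, 0 < q i) (q_sum1 : \sum_i q i = 1)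
    (q_neq_p : forall i, q i != p i)
    (w_gt0 : forall i, 0 < w i)
    (m1_ge_m2 : slope p q w idx1 >= slope p q w idx2)
    (m2_ge_m3 : slope p q w idx2 >= slope p q w idx3) :
  (case_holds p q w 1 \/ case_holds p q w 2) /\
  forall j : nat, case_holds p q w j ->
  forall mu : R, 0 <= mu <= money_threshold p q w j ->
    (forall delta : 'I_3 -> R,
       optimal p q w mu delta <->
       forall i : 'I_3,
         delta i = if i.+1 != (2 * j)%N
                   then v p q w i (2 * j) / (j.+1%:R * diff p q i) * mu
                   else 0) /\
    R_SED p q w mu = mu ^+ 2 / (j.+1%:R * slope_var p q w (2 * j)).
Proof.
have d0 i : diff p q i != 0 by rewrite subr_eq0.
have wE i : w i = diff p q i * slope p q w i.
  by rewrite /slope; field; exact: d0.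
have dm_gt0 i : 0 < diff p q i * slope p q w i by rewrite -wE.
have := sum_diff p_sum1 q_sum1; rewrite sum_ord3 /= => sd.
have mean2 : slope_mean p q w 2 = (slope p q w idx1 + slope p q w idx3) / 2.
  by rewrite /slope_mean card_others2 sum_ord3 /= addr0.
have mean4 : slope_mean p q w 4 =
    (slope p q w idx1 + slope p q w idx2 + slope p q w idx3) / 3.
  by rewrite /slope_mean card_others4 sum_ord3.
(* Since [w i] is positive, [diff p q i] and the slope have the same strict sign. *)
have d_gt0 i : 0 <= slope p q w i -> 0 < diff p q i by have := dm_gt0 i; nra.
have d_lt0 i : slope p q w i <= 0 -> diff p q i < 0 by have := dm_gt0 i; nra.
(* If the largest slope were nonpositive, all the differences would be negative, yet they sum to
   zero. The smallest slope is treated symmetrically. *)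
have m1_gt0 : 0 < slope p q w idx1.
  by rewrite ltNge; apply/negP => m1; have := d_lt0 idx1; have := d_lt0 idx2;
    have := d_lt0 idx3; lra.
have m3_lt0 : slope p q w idx3 < 0.
  by rewrite ltNge; apply/negP => m3; have := d_gt0 idx1; have := d_gt0 idx2;
    have := d_gt0 idx3; lra.
have d1_gt0 : 0 < diff p q idx1 by apply: d_gt0; exact: ltW.
have d3_lt0 : diff p q idx3 < 0 by apply: d_lt0; exact: ltW.
have m3_lt_m1 : slope p q w idx3 < slope p q w idx1 by lra.
split.
  rewrite /case_holds.
  by have [le|lt] := leP (w idx2) (diff p q idx2 * slope_mean p q w 2);
    [left | right].
move=> [|[|[|//]]] //= casej mu /andP[mu0 mu_le].
(* [mean2] is the midpoint of the two extreme slopes, hence strictly between them; the case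
   hypothesis is the first-order condition at the dropped index. *)
- have := @optimal_proportional_disclosure _ p q w 2 mu.
  rewrite /proportional_disclosure card_others2; apply=> //.
  + by apply: ord3_ind => //= _; rewrite mean2; nra.
  + by apply: ord3_ind => //= _; case: casej.
  + by move=> i li; apply: le_trans mu_le _; exact: (@money_threshold_le _ p q w 1).
- have := @optimal_proportional_disclosure _ p q w 4 mu.
  rewrite /proportional_disclosure card_others4; apply=> //.
  (* For the middle index, [m2 - mean4] is two thirds of [m2 - mean2], so the case hypothesis gives
     the required sign. *)
  + move: casej; rewrite wE mean2 => casej.
    by apply: ord3_ind => //= _; rewrite mean4; nra.
  + by apply: ord3_ind.
  + by move=> i li; apply: le_trans mu_le _; exact: (@money_threshold_le _ p q w 2).
Qed.
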